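(* Let $k$ be a field of characteristic $p>0$, $A=k[x_1,\dots,x_r]/(x_1^p,\dots,x_r^p)$, and $\zeta$ a homogeneous element of $S=k[\zeta_1,\dots,\zeta_r]\subseteq\operatorname{Ext}^*_A(k,k)$. Then for every finitely generated $A$-module $M$ there is an isomorphism of $A$-modules \[ \Delta_{\mathrm{Gr}}(L_\zeta\otimes_kM)\cong\Delta_{\mathrm{Lie}}(L_\zeta\otimes_kM). \]
   Context: $A$ is the group algebra of the elementary abelian group $E=\langle g_1,\dots,g_r\rangle$, $x_i=g_i-1$. Two Hopf structures: $\Delta_{\mathrm{Gr}}(x_i)=x_i\otimes1+x_i\otimes x_i+1\otimes x_i$ (i.e. $g\mapsto g\otimes g$) and $\Delta_{\mathrm{Lie}}(x_i)=x_i\otimes1+1\otimes x_i$. For a comultiplication $\Delta$ and modules $X,M$, $\Delta(X\otimes_kM)$ denotes $X\otimes_kM$ with action $\alpha(x\otimes m)=\sum_{(\alpha)}\alpha_1x\otimes\alpha_2m$, $\Delta(\alpha)=\sum\alpha_1\otimes\alpha_2$. $\zeta_i\in\operatorname{Ext}^2_A(k,k)$: with $P^{(i)}_*$ the resolution $\cdots\to A_i\xrightarrow{x_i}A_i\xrightarrow{x_i^{p-1}}A_i\xrightarrow{x_i}A_i\to0$ of $k$ over $A_i=k[x_i]/(x_i^p)$ and $P_*=\bigotimes_iP^{(i)}_*$ (summands $P_{j_1,\dots,j_r}\cong A$), $\zeta_i$ is the class of the cochain equal to the augmentation on $P_{j_1,\dots,j_r}$ with $j_i=2$, $j_\ell=0$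 ($\ell\ne i$), zero elsewhere; equivalently $\zeta_i$ is the Bockstein of the degree-one class $\eta_i$ (and $\zeta_i=\eta_i^2$ when $p=2$). $L_\zeta$: for $\zeta\in\operatorname{Ext}^d_A(k,k)$, let $\Omega^d(k)$ be the $d$th syzygy of $k$ in a minimal projective resolution; $\zeta$ is represented by a unique homomorphism $\Omega^d(k)\to k$ and $L_\zeta$ is its kernel. *)

(* Defs.v *)
From HB Require Import structures.
From mathcomp Require Import all_boot all_order all_algebra.
Set Implicit Arguments. Unset Strict Implicit. Unset Printing Implicit Defensive.
Import GRing.Theory.
Local Open Scope ring_scope.

(* Modules over A = k[x_1..x_r]/(x_i^p) are encoded as a finite dimension
   together with the matrices of the actions of x_1,...,x_r (acting on row
   vectors, MathComp convention; A is commutative so this is harmless). *)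
Record Amod (k : fieldType) (r : nat) := AMod {
  mdim : nat;
  mact : 'I_r -> 'M[k]_mdim }.

Section Defs.
Variables (k : fieldType) (r p : nat).

Definition is_Amod (M : Amod k r) : Prop :=
  (forall i j, mact M i *m mact M j = mact M j *m mact M i) /\
  (forall i, mact M i ^+ p = 0).

Definition Amod_iso (M N : Amod k r) : Prop :=
  exists P : 'M[k]_(mdim M, mdim N),
    [/\ row_free P, row_full P & forall i, mact M i *m P = P *m mact N i].

Definition fmx (T U : finType) (f : T -> U -> k) : 'M[k]_(#|T|, #|U|) :=
  \matrix_(i, j) f (enum_val i) (enum_val j).

Definition tensmx m1 n1 m2 n2 (X : 'M[k]_(m1, n1)) (Y : 'M[k]_(m2, n2))
  : 'M[k]_(#|{: 'I_m1 * 'I_m2}|, #|{: 'I_n1 * 'I_n2}|) :=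
  fmx (fun (u : 'I_m1 * 'I_m2) (v : 'I_n1 * 'I_n2) => X u.1 v.1 * Y u.2 v.2).

Definition tens_Gr (X M : Amod k r) : Amod k r :=
  @AMod k r #|{: 'I_(mdim X) * 'I_(mdim M)}|
    (fun i => tensmx (mact X i) 1%:M + tensmx (mact X i) (mact M i)
              + tensmx 1%:M (mact M i)).

Definition tens_Lie (X M : Amod k r) : Amod k r :=
  @AMod k r #|{: 'I_(mdim X) * 'I_(mdim M)}|
    (fun i => tensmx (mact X i) 1%:M + tensmx 1%:M (mact M i)).

(* ---- The resolution P_* = (x)_i P^(i)_* ---- *)
(* basis monomials x^b of A, b_i < p *)
Definition Mon := {ffun 'I_r -> 'I_p}.
Definition Idx (m : nat) :=
  {j : {ffun 'I_r -> 'I_m.+1} | (\sum_(i < r) (j i : nat) == m)%N}.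
Definition jf m (u : Idx m) : {ffun 'I_r -> 'I_m.+1} := sval u.
(* k-basis of P_m = (+)_{|j| = m} P_{j_1,...,j_r},  P_j = A *)
Definition PT (m : nat) : finType := (Idx m * Mon)%type.
Definition pj m (u : PT m) : {ffun 'I_r -> 'I_m.+1} := sval u.1.
Definition pb m (u : PT m) : {ffun 'I_r -> 'I_p} := u.2.

(* action of x_i on A-basis of P_m: x^b |-> x^(b+e_i) (0 if b_i = p-1) *)
Definition Pact (m : nat) (i : 'I_r) : 'M[k]_#|PT m| :=
  fmx (fun (u v : PT m) =>
    ((pj u == pj v :> {ffun 'I_r -> 'I_m.+1}) && ((pb v i : nat) == (pb u i).+1)
     && [forall l, (l != i) ==> (pb v l == pb u l)])%:R).

(* the differential d_m : P_m -> P_{m-1}, m = m'.+1.  On the summand P_j the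
   component P_j -> P_{j - e_i} is (-1)^(j_1+...+j_{i-1}) times
   multiplication by x_i if j_i is odd and by x_i^(p-1) if j_i is even (>0). *)
Definition dmx (m' : nat) : 'M[k]_(#|PT m'.+1|, #|PT m'|) :=
  fmx (fun (u : PT m'.+1) (v : PT m') =>
    \sum_(i < r)
      if [&& ((pj v) i : nat).+1 == (pj u) i,
             [forall l, (l != i) ==> (((pj v) l : nat) == (pj u) l)],
             (pb v i : nat) == (pb u i + (if odd ((pj u) i) then 1 else p.-1))%N
           & [forall l, (l != i) ==> (pb v l == pb u l)]]
      then (-1) ^+ (\sum_(l < r | (l < i)%N) ((pj u) l : nat))
      else 0).

Definition augmx : 'M[k]_(#|PT 0|, #|{: unit}|) :=
  fmx (fun (u : PT 0) (_ : unit) => [forall l, pb u l == 0 :> nat]%:R).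

(* target of the m-th map of the augmented resolution: P_{m-1}, or k if m = 0 *)
Definition QT (m : nat) : finType :=
  match m with 0 => (unit : finType) | m'.+1 => PT m' end.

Definition Qact (m : nat) : 'I_r -> 'M[k]_#|QT m| :=
  match m return 'I_r -> 'M[k]_#|QT m| with
  | 0 => fun _ => 0
  | m'.+1 => Pact m'
  end.

Definition Dmx (m : nat) : 'M[k]_(#|PT m|, #|QT m|) :=
  match m return 'M[k]_(#|PT m|, #|QT m|) with
  | 0 => augmx
  | m'.+1 => dmx m'
  end.

(* A homogeneous element zeta = sum_{|a| = n} c_a zeta_1^a_1 ... zeta_r^a_r of
   S in Ext^{2n}_A(k,k) (coefficients c_a for |a| <> n are ignored).  The
   monomial zeta^a is represented by the cochain equal to the augmentation on
   the summand P_{2a} of P_{2n} and zero elsewhere, so zeta is represented by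
   the following cochain f_zeta : P_{2n} -> k (a column vector). *)
Definition zeta_cochain (n : nat) (c : {ffun 'I_r -> 'I_n.+1} -> k)
  : 'M[k]_(#|PT n.*2|, 1) :=
  \matrix_(t, _) let u := enum_val t in
     if [forall l, ~~ odd ((pj u) l)]
     then c [ffun l => inord ((pj u) l)./2] *
          [forall l, pb u l == 0 :> nat]%:R
     else 0.

(* L_zeta = kernel of the map Omega^{2n}(k) -> k induced by f_zeta, where
   Omega^{2n}(k) = d_{2n}(P_{2n}) (P_* is a minimal resolution).  Concretely
   L_zeta = d_{2n}(ker f_zeta), a submodule of P_{2n-1} (of k when n = 0);
   its module structure is the restriction of the action, expressed in the
   basis row_base of this subspace. *)
Definition Lzeta (n : nat) (c : {ffun 'I_r -> 'I_n.+1} -> k) : Amod k r :=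
  let U := kermx (zeta_cochain c) *m Dmx n.*2 in
  let B := row_base U in
  @AMod k r (\rank U) (fun i => B *m Qact n.*2 i *m pinvmx B).

End Defs.

(* Main.v *)
(* Give the basis vector x^b of the summand P_j of P_* the weight
   w_i = b_i + (j_i mod 2) in (Z/p)^r.  Then x_i has degree delta_i, while the
   differential of P_* has degree 0 (x_i^(p-1) goes from even to odd j_i, and
   p = 0), and so has every cocycle f_zeta with zeta in k[zeta_1, ..., zeta_r],
   being supported on even j and b = 0.  Hence L_zeta is (Z/p)^r-graded.  For any
   such graded module X, the map u (x) m |-> u (x) prod_i (1 + x_i)^(- w_i(u)) m,
   well defined since (1 + x_i)^p = 1 on M, carries the action of
   x_i (x) (1 + x_i) + 1 (x) x_i to that of x_i (x) 1 + 1 (x) x_i. *)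
Require Import Defs.
From HB Require Import structures.
From mathcomp Require Import all_boot all_order all_algebra.
Set Implicit Arguments. Unset Strict Implicit. Unset Printing Implicit Defensive.
Import GRing.Theory.
Local Open Scope ring_scope.

(** * Kronecker products of matrices indexed by finite types *)

Section Tensor.
Variable k : fieldType.

Lemma mul_fmx (T U V : finType) (f : T -> U -> k) (g : U -> V -> k) :
  fmx f *m fmx g = fmx (fun t v => \sum_u f t u * g u v).
Proof.
apply/matrixP=> a b; rewrite !mxE (reindex _ (onW_bij _ (@enum_val_bij U))).
by apply: eq_bigr => j _; rewrite !mxE.
Qed.

Lemma eq_fmx (T U : finType) (f g : T -> U -> k) :
  (forall t u, f t u = g t u) -> fmx f = fmx g.
Proof. by move=> fg; apply/matrixP=> a b; rewrite !mxE. Qed.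

Lemma tensmxM m1 n1 q1 m2 n2 q2 (X : 'M[k]_(m1, n1)) (X' : 'M[k]_(n1, q1))
    (Y : 'M[k]_(m2, n2)) (Y' : 'M[k]_(n2, q2)) :
  tensmx X Y *m tensmx X' Y' = tensmx (X *m X') (Y *m Y').
Proof.
rewrite mul_fmx; apply: eq_fmx => u v; rewrite !mxE big_distrlr /=.
by rewrite pair_bigA; apply: eq_bigr => w _; rewrite mulrACA.
Qed.

Lemma tensmx11 m n : tensmx 1%:M 1%:M = 1%:M :> 'M[k]_#|{: 'I_m * 'I_n}|.
Proof.
apply/matrixP=> a b; rewrite !mxE -natrM mulnb -(inj_eq enum_val_inj).
by rewrite -xpair_eqE -!surjective_pairing.
Qed.

Lemma tensmxDr m1 n1 m2 n2 (X : 'M[k]_(m1, n1)) (Y Y' : 'M[k]_(m2, n2)) :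
  tensmx X (Y + Y') = tensmx X Y + tensmx X Y'.
Proof. by apply/matrixP=> a b; rewrite !mxE mulrDr. Qed.

Lemma tensmx0l m1 n1 m2 n2 (Y : 'M[k]_(m2, n2)) :
  tensmx (0 : 'M[k]_(m1, n1)) Y = 0.
Proof. by apply/matrixP=> a b; rewrite !mxE mul0r. Qed.

Lemma tensmx_suml I s (P : pred I) m1 n1 m2 n2 (X : I -> 'M[k]_(m1, n1))
    (Y : 'M[k]_(m2, n2)) :
  \sum_(i <- s | P i) tensmx (X i) Y = tensmx (\sum_(i <- s | P i) X i) Y.
Proof.
apply/matrixP=> a b; rewrite !mxE !summxE mulr_suml.
by apply: eq_bigr => i _; rewrite !mxE.
Qed.

End Tensor.

(** * Commuting units of order dividing p, with exponents in Z/p *)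

Lemma expr_add1_pchar (k : fieldType) (p d : nat) (X : 'M[k]_d) :
  prime p -> p \in [pchar k] -> X ^+ p = 0 -> (X + 1) ^+ p = 1.
Proof.
move=> pP pk Xp; rewrite exprD1n (bigD1 ord0)// (bigD1 ord_max)/=; last first.
  by rewrite -val_eqE /= -lt0n prime_gt0.
rewrite bin0 expr0 mulr1n Xp mul0rn add0r big1 ?addr0// => i /andP[i0 im].
(* The binomial coefficient vanishes in [k] for 0 < i < p, so the expansion keeps only its extreme
   terms: 1 for i = 0 and [X ^+ p], which is 0, for i = p. *)
have /dvdnP[q ->] : (p %| 'C(p, i))%N.
  rewrite prime_dvd_bin// lt0n i0/= ltn_neqAle -ltnS ltn_ord andbT.
  by move: im; rewrite -val_eqE.
by rewrite -scaler_nat natrM (pcharf0 pk) mulr0 scale0r.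
Qed.

Definition ffdelta {r p : nat} (i : 'I_r) : {ffun 'I_r -> 'Z_p} :=
  [ffun l => (l == i)%:R].

Section UnitPower.
Variables (k : fieldType) (r p d : nat) (U : 'I_r -> 'M[k]_d).
Hypotheses (p_gt1 : (1 < p)%N) (Up : forall i, U i ^+ p = 1).
Hypothesis Ucomm : forall i j, U i * U j = U j * U i.

Definition upow (e : {ffun 'I_r -> 'Z_p}) : 'M[k]_d := \prod_i U i ^+ (e i : nat).

Lemma upow0 : upow 0 = 1.
Proof. by apply: big1 => i _; rewrite ffunE expr0. Qed.

(** Commutation merges the two products factor by factor; exponents in ['Z_p] add modulo p, and [Up]
    absorbs the carry. *)
Lemma upowD e f : upow (e + f) = upow e * upow f.
Proof.
rewrite /upow -prodrM_comm => [|i j _ _]; last first.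
  exact/commrX/commr_sym/commrX/Ucomm.
apply: eq_bigr => i _; rewrite ffunE -exprD.
by rewrite expr_mod// Zp_cast.
Qed.

Lemma upow_delta i : upow (ffdelta i) = U i.
Proof.
rewrite /upow (eq_bigr (fun l => if l == i then U i else 1)) => [|l _].
  by rewrite -big_mkcond big_pred1_eq.
by rewrite ffunE; case: eqP => [->|].
Qed.

Lemma upow_comm X e : (forall i, X * U i = U i * X) -> X * upow e = upow e * X.
Proof. by move=> XU; apply: commr_prod => i _; apply/commrX/XU. Qed.

End UnitPower.

(* A (Z/p)^r-grading of a module, encoded by the projections [E e] onto its
   components. *)
Definition grading (k : fieldType) (r p m : nat) (Q : 'I_r -> 'M[k]_m)
    (E : {ffun 'I_r -> 'Z_p} -> 'M[k]_m) : Prop :=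
  [/\ \sum_e E e = 1%:M,
      forall e f, E e *m E f = if e == f then E e else 0
    & forall i e, Q i *m E (e + ffdelta i) = E e *m Q i].

(** * Comparison of the two tensor actions on a graded module *)

Lemma graded_tens_iso (k : fieldType) (r p : nat) (X M : Amod k r) E :
  prime p -> p \in [pchar k] -> is_Amod p M -> grading (p := p) (mact X) E ->
  Amod_iso (tens_Gr X M) (tens_Lie X M).
Proof.
move=> pP pk [Mcomm Mp] [E1 EE XE]; have p_gt1 := prime_gt1 pP.
pose U i := mact M i + 1.
have Up i : U i ^+ p = 1 by exact: expr_add1_pchar.
have MU i j : mact M i * U j = U j * mact M i.
  by rewrite mulrDr mulrDl mulr1 mul1r -!mulmxE Mcomm.
have UU i j : U i * U j = U j * U i.
  by rewrite [U i]/U mulrDl (mulrDr (U j)) mul1r mulr1 MU.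
pose W := upow U (p := p).
have WN e f : e + f = 0 -> W e *m W f = 1%:M.
  by move=> ef; rewrite mulmxE -(upowD p_gt1 Up UU) ef upow0.
(* On the component of degree e, [P] acts on the second factor by the product of the (1 +
   x_i)^(-e_i). Orthogonality of the [E e] makes the same sum with [W e] its inverse. *)
pose P := \sum_e tensmx (E e) (W (- e)).
have PQ : P *m (\sum_e tensmx (E e) (W e)) = 1%:M.
  rewrite mulmx_suml -tensmx11 -E1 -tensmx_suml; apply: eq_bigr => e _.
  rewrite mulmx_sumr (bigD1 e)//= tensmxM EE eqxx WN ?addNr// big1 ?addr0//.
  by move=> f /negPf fe; rewrite tensmxM EE eq_sym fe tensmx0l.
have [Pu _] := mulmx1_unit PQ.
exists P; split; rewrite ?row_free_unit ?row_full_unit// => i /=.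
have -> : tensmx (mact X i) 1%:M + tensmx (mact X i) (mact M i)
    = tensmx (mact X i) (U i) by rewrite -tensmxDr addrC.
rewrite mulmxDl mulmxDr; congr (_ + _); last first.
  rewrite mulmx_sumr mulmx_suml; apply: eq_bigr => e _.
  by rewrite !tensmxM mulmx1 mul1mx !mulmxE upow_comm.
(* Since x_i raises the degree by [ffdelta i], the term of index e + [ffdelta i] on the left meets
   that of index e on the right; the factor [U i] turns [W (- (e + ffdelta i))] into [W (- e)]. *)
rewrite mulmx_sumr mulmx_suml (reindex_inj (addIr (ffdelta i))).
apply: eq_bigr => e _; rewrite !tensmxM XE mulmx1; congr tensmx.
by rewrite mulmxE -(upow_delta p U i) -(upowD p_gt1 Up UU) opprD addrCA subrr addr0.
Qed.

(** * Gradings given by weights of basis vectors, and their restriction *)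

Section HomogeneousProjections.
Variables (k : fieldType) (r p : nat).
Local Notation G := {ffun 'I_r -> 'Z_p}.

Definition hproj m (wt : 'I_m -> G) (e : G) : 'M[k]_m :=
  diag_mx (\row_j (wt j == e)%:R).

Lemma sum_hproj m (wt : 'I_m -> G) : \sum_e hproj wt e = 1%:M.
Proof.
rewrite -linear_sum /= -diag_const_mx; congr diag_mx; apply/rowP=> j.
rewrite summxE (bigD1 (wt j))//= !mxE eqxx big1 ?addr0// => e ne.
by rewrite mxE eq_sym (negPf ne).
Qed.

Lemma hprojM m (wt : 'I_m -> G) e f :
  hproj wt e *m hproj wt f = if e == f then hproj wt e else 0.
Proof.
rewrite mulmx_diag; case: eqP => [<-|/eqP/negPf ef].
  by congr diag_mx; apply/rowP=> j; rewrite !mxE -natrM mulnb andbb.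
rewrite -[RHS](linear0 (@diag_mx k m)); congr diag_mx; apply/rowP=> j.
rewrite !mxE -natrM mulnb; case: eqP => [->|//].
by rewrite ef.
Qed.

(** Entrywise, both sides multiply [A i j] by an indicator, and the two indicators agree wherever
    [A i j] is nonzero. It serves with d = [ffdelta i] for actions and d = 0 for the differential
    and the cochain. *)
Lemma hproj_homog m n (wt : 'I_m -> G) (wt' : 'I_n -> G) d (A : 'M[k]_(m, n)) :
  (forall i j, A i j != 0 -> wt' j = wt i + d) ->
  forall e, A *m hproj wt' (e + d) = hproj wt e *m A.
Proof.
move=> Ad e; rewrite mul_mx_diag mul_diag_mx; apply/matrixP=> i j; rewrite !mxE.
have [->|/Ad->] := eqVneq (A i j) 0; first by rewrite mul0r mulr0.
by rewrite (inj_eq (addIr d)) mulrC.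
Qed.

(** Stability under A gives [B *m A *m pinvmx B *m B = B *m A], so passing to coordinates in the
    basis [B] respects products, and the grading identities carry over. *)
Lemma grading_submodule N m (Q : 'I_r -> 'M[k]_N) E (U : 'M[k]_(m, N)) :
  let B := row_base U in
  grading (p := p) Q E ->
  (forall i, (U *m Q i <= U)%MS) -> (forall e, (U *m E e <= U)%MS) ->
  grading (fun i => B *m Q i *m pinvmx B)
    (fun e => B *m E e *m pinvmx B).
Proof.
move=> B [E1 EE QE] UQ UE.
have BB : B *m pinvmx B = 1%:M by apply/mulmxVp/row_base_free.
have stab (A : 'M_N) : (U *m A <= U)%MS -> B *m A *m pinvmx B *m B = B *m A.
  move=> UA; apply: mulmxKpV; rewrite eq_row_base.
  by apply: submx_trans UA; rewrite submxMr// eq_row_base.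
move: (pinvmx B) BB stab; move: B => C D CD stab.
split => [|e f|i e].
- by rewrite -mulmx_suml -mulmx_sumr E1 mulmx1.
- rewrite !mulmxA stab// -(mulmxA C) EE.
  by case: eqP => // _; rewrite mulmx0 mul0mx.
- by rewrite !mulmxA !stab// -!(mulmxA C) QE.
Qed.

End HomogeneousProjections.

(** * Linearity and homogeneity of the resolution and of the cochain *)

Section Resolution.
Variables (k : fieldType) (r p : nat).
Hypothesis p_gt1 : (1 < p)%N.

(** Matrix entry of multiplication by x^a in the monomial basis. The exponents are added in [nat],
    so an overflow past p - 1 matches no monomial and gives 0, as x_i^p = 0 demands. *)
Definition mon_shift (a : 'I_r -> nat) (b b' : Mon r p) : bool :=
  [forall l, (b' l : nat) == (b l + a l)%N].

Lemma mul_mon_shift a a' b b'' :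
  \sum_b' (mon_shift a b b')%:R * (mon_shift a' b' b'')%:R
    = (mon_shift (fun l => a l + a' l)%N b b'')%:R :> k.
Proof.
case: (boolP (mon_shift _ b b'')) => [/forallP bb''|nbb''].
  (* The only possible middle monomial is x^(b + a); its exponents are below p because those of b''
     bound them. *)
  have ltp l : (b l + a l < p)%N.
    by rewrite (leq_ltn_trans _ (ltn_ord (b'' l)))// (eqP (bb'' l)) addnA leq_addr.
  rewrite (bigD1 [ffun l => Ordinal (ltp l)])//= big1 ?addr0 => [|b' ne].
    rewrite -natrM mulnb (_ : _ && _ = true)//.
    apply/andP; split; apply/forallP=> l; rewrite ffunE//=.
    by rewrite -addnA; exact: bb''.
  rewrite -natrM mulnb; case: andP => // -[/forallP bb' _]; case/eqP: ne.
  by apply/ffunP=> l; apply/val_inj; rewrite ffunE /= (eqP (bb' l)).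
rewrite big1// => b' _; rewrite -natrM mulnb; case: andP => // -[/forallP bb'].
move=> /forallP b'b''; case/negP: nbb''; apply/forallP=> l.
by rewrite (eqP (b'b'' l)) (eqP (bb' l)) addnA.
Qed.

Definition dsign m i (j : Idx r m.+1) (j' : Idx r m) : k :=
  if ((jf j' i).+1 == jf j i :> nat)
     && [forall l, (l != i) ==> (jf j' l == jf j l :> nat)]
  then (-1) ^+ (\sum_(l < r | (l < i)%N) (jf j l : nat)) else 0.

Definition dstep m i (j : Idx r m) (l : 'I_r) : nat :=
  if l == i then (if odd (jf j i) then 1 else p.-1)%N else 0%N.

Lemma mon_shift_at i (c : nat) (b b' : Mon r p) :
  mon_shift (fun l => if l == i then c else 0%N) b b' =
  ((b' i : nat) == (b i + c)%N) && [forall l, (l != i) ==> (b' l == b l)].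
Proof.
apply/forallP/andP => [bb'|[b'i /forallP b'l] l].
  split; first by have := bb' i; rewrite eqxx.
  by apply/forallP=> l; apply/implyP=> /negPf li; have := bb' l; rewrite li addn0.
have [->//|/negPf li] := eqVneq l i; have := b'l l.
by rewrite li addn0 => /eqP->.
Qed.

Lemma PactE m i :
  Pact k p m i = fmx (fun u v : PT r p m => (u.1 == v.1)%:R *
    (mon_shift (fun l => if l == i then 1 else 0)%N u.2 v.2)%:R).
Proof.
by apply: eq_fmx => u v; rewrite -natrM mulnb mon_shift_at addn1 -andbA.
Qed.

Lemma dmxE m : dmx k r p m = fmx (fun (u : PT r p m.+1) (v : PT r p m) =>
  \sum_i dsign i u.1 v.1 * (mon_shift (dstep i u.1) u.2 v.2)%:R).
Proof.
apply: eq_fmx => u v; apply: eq_bigr => i _; rewrite mon_shift_at /dsign.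
rewrite -[pj u]/(jf u.1) -[pj v]/(jf v.1) -[pb u]/u.2 -[pb v]/v.2.
by case: eqP; case: forallP => /=; case: andP; rewrite ?mulr1 ?mulr0 ?mul0r.
Qed.

(** The action fixes the summand index j and the differential multiplies by monomials, so both
    composites collapse to one sum in which the two shifts add up. *)
Lemma Pact_dmx m i : Pact k p m.+1 i *m dmx k r p m = dmx k r p m *m Pact k p m i.
Proof.
rewrite !PactE !dmxE !mul_fmx; apply: eq_fmx => u w.
transitivity (\sum_l dsign l u.1 w.1 * (mon_shift (fun t =>
    (if t == i then 1 else 0) + dstep l u.1 t)%N u.2 w.2)%:R).
  rewrite -(pair_bigA _ (fun j b => (u.1 == j)%:R * (mon_shift _ u.2 b)%:R *
    \sum_l dsign l j w.1 * (mon_shift (dstep l j) b w.2)%:R)) /=.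
  rewrite (bigD1 u.1)//= [X in _ + X]big1 ?addr0 => [|j ne]; last first.
    by apply: big1 => b _; rewrite eq_sym (negPf ne) !mul0r.
  under eq_bigr do rewrite eqxx mul1r mulr_sumr.
  rewrite exchange_big; apply: eq_bigr => l _; rewrite -mul_mon_shift mulr_sumr.
  by apply: eq_bigr => b _; rewrite mulrCA.
rewrite -(pair_bigA _ (fun j b => (\sum_l dsign l u.1 j *
  (mon_shift (dstep l u.1) u.2 b)%:R) * ((j == w.1)%:R * (mon_shift _ b w.2)%:R))) /=.
rewrite (bigD1 w.1)//= [X in _ = _ + X]big1 ?addr0 => [|j ne]; last first.
  by apply: big1 => b _; rewrite (negPf ne) mul0r mulr0.
under [RHS]eq_bigr do rewrite eqxx mul1r mulr_suml.
rewrite exchange_big; apply: eq_bigr => l _.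
under [RHS]eq_bigr do rewrite -mulrA.
rewrite -mulr_sumr mul_mon_shift; congr (_ * (nat_of_bool _)%:R).
by apply: eq_forallb => t; rewrite (addnC (dstep _ _ _)).
Qed.


Lemma Pact_Dmx m i : Pact k p m i *m Dmx k r p m = Dmx k r p m *m Qact k p m i.
Proof.
case: m => [|m]; last exact: Pact_dmx.
rewrite mulmx0 mul_fmx; apply/matrixP=> a b; rewrite !mxE; apply: big1 => v _.
case: andP => [[/andP[_ /eqP bi] _]|]; last by rewrite mul0r.
case: forallP => [/(_ i)|]; last by rewrite mulr0.
by rewrite bi.
Qed.

Lemma Pact_zeta n (c : {ffun 'I_r -> 'I_n.+1} -> k) i :
  Pact k p n.*2 i *m zeta_cochain p c = 0.
Proof.
apply/matrixP=> a b; rewrite !mxE; apply: big1 => v _; rewrite !mxE.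
case: andP => [[/andP[_ /eqP bi] _]|]; last by rewrite mul0r.
rewrite /= mul1r; case: ifP => // _.
case: forallP => [/(_ i)|]; last by rewrite mulr0.
by rewrite bi.
Qed.

Definition Pwt m (u : PT r p m) : {ffun 'I_r -> 'Z_p} :=
  [ffun i => (pb u i + odd (pj u i))%:R].

Definition Qwt m : QT r p m -> {ffun 'I_r -> 'Z_p} :=
  match m with 0 => fun=> 0 | m'.+1 => @Pwt m' end.

Lemma Pact_homog m i a b : Pact k p m i a b != 0 ->
  Pwt (enum_val b) = Pwt (enum_val a) + ffdelta i.
Proof.
rewrite mxE; case: andP => [[/andP[/eqP ej /eqP ei] /forallP el] _|]; last by rewrite eqxx.
apply/ffunP=> l; rewrite !ffunE ej -natrD; congr _%:R.
have [->|li] := eqVneq l i; first by rewrite ei addn1 addSn.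
by have := el l; rewrite li addn0 => /eqP->.
Qed.

Lemma Qact_grading m :
  grading (Qact k p m) (hproj k (@Qwt m \o enum_val)).
Proof.
split=> [|e f|i]; first exact: sum_hproj; first exact: hprojM.
apply: hproj_homog => a b; case: m a b => [|m] a b; last exact: Pact_homog.
by rewrite mxE eqxx.
Qed.

Lemma Dmx_homog m a b :
  Dmx k r p m a b != 0 -> Qwt (enum_val b) = Pwt (enum_val a).
Proof.
case: m a b => [|m] a b; rewrite mxE.
  case: forallP => [b0 _|]; last by rewrite eqxx.
  apply/ffunP=> l; rewrite !ffunE (eqP (b0 l)).
  by case: (pj _ l) => -[|].
have [//|ne] := eqVneq (Qwt (enum_val b)) (Pwt (enum_val a)).
case/eqP; apply: big1 => i _.
case: and4P => // -[/eqP ji /forallP jl /eqP bi /forallP bl]; case/eqP: ne.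
apply/ffunP=> l; rewrite !ffunE; have [->|li] := eqVneq l i; last first.
  by have := jl l; have := bl l; rewrite li => /eqP-> /eqP->.
(* From odd to even j_i, the exponent gains 1 and the parity loses 1; from even to odd, the gains p
   - 1 and 1 total p, which is 0 in ['Z_p]. *)
rewrite bi -ji oddS; case: (odd _) => /=; rewrite addn0.
  rewrite -addnA addn1 prednK ?(ltnW p_gt1)// natrD.
  by rewrite pchar_Zp// addr0.
by [].
Qed.

Lemma zeta_homog n (c : {ffun 'I_r -> 'I_n.+1} -> k) a b :
  zeta_cochain p c a b != 0 -> Pwt (enum_val a) = 0.
Proof.
rewrite mxE /=; case: forallP => [je|]; last by rewrite eqxx.
case: forallP => [b0 _|]; last by rewrite mulr0 eqxx.
by apply/ffunP=> l; rewrite !ffunE (eqP (b0 l)) (negPf (je l)).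
Qed.

End Resolution.

(** * The induced grading on L_zeta *)

Theorem theorem5p1 (k : fieldType) (p r : nat) (hp : prime p)
  (hchar : p \in [pchar k]) (n : nat) (c : {ffun 'I_r -> 'I_n.+1} -> k)
  (M : Amod k r) (hM : is_Amod p M) :
  Amod_iso (tens_Gr (Lzeta p c) M) (tens_Lie (Lzeta p c) M).
Proof.
have p_gt1 := prime_gt1 hp.
apply: (graded_tens_iso hp hchar hM); rewrite /Lzeta /=.
apply: (grading_submodule (Qact_grading k r p n.*2)) => [i|e].
  (* The action passes through the differential to P_{2n}, where it preserves the kernel of the
     cochain because the cochain kills every multiple of x_i. *)
  rewrite -mulmxA -Pact_Dmx// mulmxA submxMr// sub_kermx -mulmxA.
  by rewrite Pact_zeta// mulmx0.
(* Likewise the projections pass to P_{2n}, the differential having degree 0; they preserve the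
   kernel because the cochain is homogeneous of degree 0 once its target [k] gets weight 0. *)
rewrite -mulmxA -[e]addr0 (hproj_homog (wt := @Pwt r p n.*2 \o enum_val)).
  rewrite mulmxA submxMr// sub_kermx -mulmxA.
  rewrite -(hproj_homog (wt' := fun=> 0) (d := 0)).
    by rewrite mulmxA mulmx_ker mul0mx.
  by move=> a b /zeta_homog wa; rewrite /= wa addr0.
by move=> a b /(Dmx_homog p_gt1) wab; rewrite /= wab addr0.
Qed.
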